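(* The following hold. (1) For $a=1,\ldots,\rho_C$, the polynomial $f_a\big(\mathcal{A}^{(B,\mathbf b)},t\big)$ can be written in the form $$f_a\big(\mathcal{A}^{(B,\mathbf b)},t\big)=\sum_{J\subseteq[m],\ \bar r(J)=r(J)}(-1)^{\#J}\tilde{d}_J(a)\,t^{n-r(J)}.$$ (2) For any integers $1\le a,b\le\rho_C$, if $\gcd(a,\rho_C)=\gcd(b,\rho_C)$, then $f_a\big(\mathcal{A}^{(B,\mathbf b)},t\big)=f_b\big(\mathcal{A}^{(B,\mathbf b)},t\big)$. In other words, the quasi-polynomial $\chi^{\mathrm{quasi}}\big(\mathcal{A}^{(B,\mathbf b)},q\big)$ has the gcd property with respect to $\rho_C$. (3) For any integers $q>q_0$ and $1\le a\le\rho_C$, if $\gcd(q,\rho_C)=a$, then $$\chi^{\mathrm{quasi}}\big(\mathcal{A}^{(B,\mathbf b)},q\big)=f_a\big(\mathcal{A}^{(B,\mathbf b)},q\big).$$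
   Context: Let $A$ be an $m\times n$ integer matrix, $B$ an $l\times n$ integer matrix ($l=0$ is allowed), $\mathbf a\in\mathbb{Z}^m$, $\mathbf b\in\mathbb{Z}^l$, and $[m]=\{1,\dots,m\}$. (Italic $a,b$ are integers, bold $\mathbf a,\mathbf b$ are vectors.) For $J\subseteq[m]$, let $A_J$ and $\mathbf a_J$ consist of the rows of $A$ and entries of $\mathbf a$ indexed by $J$; $C_J=\begin{bmatrix}B\\ A_J\end{bmatrix}$, $\mathbf c_J=\begin{bmatrix}\mathbf b\\ \mathbf a_J\end{bmatrix}$, $\bar C_J=[C_J\ \mathbf c_J]$; $r(J)=\operatorname{rank}C_J$, $\bar r(J)=\operatorname{rank}\bar C_J$ (ranks over $\mathbb{Q}$). The invariant factors of an integer matrix are the nonzero diagonal entries (taken positive, each dividing the next) of its Smith normal form; let $d_{J,1}\mid\cdots\mid d_{J,r(J)}$ be those of $C_J$ and $\bar d_{J,1}\mid\cdots\mid\bar d_{J,\bar r(J)}$ those of $\bar C_J$. Put $\rho_C=\operatorname{lcm}\{d_{J,r(J)}: J\subseteq[m],\ \bar r(J)=r(J)\}$ and $q_0=\max\{\bar d_{J,\bar r(J)}: J\subseteq[m],\ \bar r(J)=r(J)+1\}$, with $q_0=0$ if no such $J$ exists; $d_{J,0}=1$ and the lcm of the empty set is $1$. For positive integers $q$ let $d_J(q)=\prod_{j=1}^{r(J)}\gcd(d_{J,j},q)$, and let $\tilde d_J(q)=d_J(q)$ if $\gcd(q,d_{J,j})=\gcd(q,\bar d_{J,j})$ for all $j=1,\dots,\bar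 r(J)$, and $\tilde d_J(q)=0$ otherwise, where $d_{J,\bar r(J)}:=0$ if $\bar r(J)=r(J)+1$ (and $\gcd(q,0)=q$). The characteristic quasi-polynomial is $$\chi^{\mathrm{quasi}}\big(\mathcal{A}^{(B,\mathbf b)},q\big)=\sum_{J\subseteq[m],\ \bar r(J)=r(J)}(-1)^{\#J}\tilde{d}_J(q)\,q^{n-r(J)},$$ a quasi-polynomial in $q$ with period $\rho_C$. For $j=1,\dots,\rho_C$, its $j$-constituent $f_j\big(\mathcal{A}^{(B,\mathbf b)},t\big)$ is the unique polynomial with $f_j\big(\mathcal{A}^{(B,\mathbf b)},q\big)=\chi^{\mathrm{quasi}}\big(\mathcal{A}^{(B,\mathbf b)},q\big)$ for all positive integers $q\equiv j\pmod{\rho_C}$. A quasi-polynomial with period $\rho$ and constituents $f_1,\dots,f_\rho$ has the gcd property with respect to $\rho$ if $f_a=f_b$ whenever $\gcd(a,\rho)=\gcd(b,\rho)$. *)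

(* Defs.v *)
From HB Require Import structures.
From mathcomp Require Import all_boot all_order all_algebra.

Set Implicit Arguments.
Unset Strict Implicit.
Unset Printing Implicit Defensive.

Import Order.TTheory GRing.Theory Num.Theory.
Local Open Scope ring_scope.

Definition smith_diag (m n : nat) (s : seq nat) : 'M[int]_(m, n) :=
  \matrix_(i, j) ((nth 0%N s i)%:Z *+ (i == j :> nat)).

(* The bound on [size s] matters: entries of [s] beyond the diagonal would not
   be seen by [smith_diag]. *)
Definition is_invariant_factors (m n : nat) (M : 'M[int]_(m, n)) (s : seq nat) :
  Prop :=
  [/\ (size s <= minn m n)%N, all (ltn 0) s, sorted dvdn s
    & exists L : 'M[int]_m, exists R : 'M[int]_n,
        [/\ L \in unitmx, R \in unitmx & M = L *m smith_diag m n s *m R]].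

Lemma nth_filter_sorted_dvdn (s : seq nat) (i : nat) :
  sorted dvdn s -> nth 0%N (filter (ltn 0) s) i = nth 0%N s i.
Proof.
elim: s i => [|x s IHs] //= i s_sorted.
case: x s_sorted => [|x] s_sorted /=; last first.
  by case: i => //= i; apply: IHs; apply: path_sorted s_sorted.
have s0 y : y \in s -> y = 0%N.
  move=> ys; apply/eqP; rewrite -dvd0n.
  by move: (order_path_min dvdn_trans s_sorted) => /allP; apply.
have -> : filter (ltn 0) s = [::].
  by apply/eqP; rewrite -size_eq0 size_filter -leqn0 leqNgt -has_count;
     apply/hasPn => y /s0 ->.
case: i => [|i]; rewrite nth_nil //=.
have [lt_i|le_i] := ltnP i (size s); last by rewrite nth_default.
by rewrite (s0 _ (mem_nth 0%N lt_i)).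
Qed.

Lemma invariant_factors_exist (m n : nat) (M : 'M[int]_(m, n)) :
  {s : seq nat | is_invariant_factors M s}.
Proof.
have [L uL [R uR [d d_sorted defM]]] := int_Smith_normal_form M.
pose s0 := map absz (take (minn m n) d).
have s0_sorted : sorted dvdn s0.
  by rewrite sorted_map; apply: take_sorted; apply: d_sorted.
exists (filter (ltn 0) s0); split.
- rewrite size_filter (leq_trans (count_size _ _)) // size_map size_take_min.
  exact: geq_minl.
- exact: filter_all.
- exact: (sorted_filter dvdn_trans).
pose D := diag_mx (\row_(i < m) (-1) ^+ (d`_i < 0)%R) : 'M[int]_m.
exists (L *m D), R; split=> //.
  rewrite unitmx_mul uL unitmxE det_diag.
  apply: rpred_prod => i _.
  by rewrite mxE unitrX // unitrN unitr1.
rewrite defM -!(mulmxA L); congr (_ *m (_ *m _)).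
apply/matrixP=> i j; rewrite mul_diag_mx !mxE nth_filter_sorted_dvdn //.
case: eqP => [eij|_]; last by rewrite !mulr0n mulr0.
have lt_i : (i < minn m n)%N by rewrite leq_min ltn_ord eij ltn_ord.
rewrite !mulr1n; have [lt_d|le_d] := ltnP i (size d); last first.
  rewrite !nth_default ?mulr0 //.
  by rewrite size_map size_take_min (leq_trans (geq_minr _ _)).
rewrite (nth_map 0) ?nth_take //; last by rewrite size_take_min leq_min lt_i.
by rewrite abszE mulr_sign_norm.
Qed.

Definition invariant_factors (m n : nat) (M : 'M[int]_(m, n)) : seq nat :=
  sval (invariant_factors_exist M).

Definition rankQ (m n : nat) (M : 'M[int]_(m, n)) : nat :=
  \rank (map_mx (intr : int -> rat) M).

Lemma size_invariant_factors (m n : nat) (M : 'M[int]_(m, n)) :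
  size (invariant_factors M) = rankQ M.
Proof.
rewrite /invariant_factors; case: (invariant_factors_exist M) => s /=.
case=> le_s s_gt0 _ [L [R [uL uR ->]]]; rewrite /rankQ !map_mxM.
rewrite mxrankMfree ?row_free_unit ?map_unitmx //; last first.
  by rewrite unitmxE det_map_mx rmorph_unit -?unitmxE.
rewrite (eqmxMfull _ _); last first.
  by rewrite row_full_unit unitmxE det_map_mx rmorph_unit -?unitmxE.
pose E := diag_mx (\row_(i < m)
  (if (i < size s)%N then (nth 0%N s i)%:R else 1)) : 'M[rat]_m.
have -> : map_mx intr (smith_diag m n s) = E *m pid_mx (size s) :> 'M[rat]_(m, n).
  apply/matrixP=> i j; rewrite mul_diag_mx !mxE.
  case: eqP => _ /=; last by rewrite !mulr0n mulr0.
  case: ltnP => [_|le_i]; first by rewrite mulr1n mulr1 pmulrn.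
  by rewrite nth_default // mulr0.
rewrite (eqmxMfull _ _); last first.
  rewrite row_full_unit unitmxE det_diag unitfE prodf_seq_neq0.
  apply/allP=> i _ /=; rewrite mxE; case: ltnP => // lt_i.
  rewrite pnatr_eq0 -lt0n.
  by have /allP/(_ _ (mem_nth 0%N lt_i)) := s_gt0.
by move: le_s; rewrite leq_min => /andP[le_m le_n]; rewrite rank_pid_mx.
Qed.

(* 1-based indexing, with value 1 at index 0 and value 0 beyond the rank. *)
Definition invariant_factor (m n : nat) (M : 'M[int]_(m, n)) (j : nat) : nat :=
  if j is j'.+1 then nth 0%N (invariant_factors M) j' else 1%N.

Section CharacteristicQuasiPolynomial.

Variables (m l n : nat).
Variables (A : 'M[int]_(m, n)) (av : 'cV[int]_m).
Variables (B : 'M[int]_(l, n)) (bv : 'cV[int]_l).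

Implicit Types (J : {set 'I_m}) (q j : nat).

Definition rows_in (p : nat) (M : 'M[int]_(m, p)) J : 'M[int]_(#|J|, p) :=
  rowsub (fun i : 'I_#|J| => enum_val i) M.

Definition C_ J : 'M[int]_(l + #|J|, n) := col_mx B (rows_in A J).

Definition c_ J : 'cV[int]_(l + #|J|) := col_mx bv (rows_in av J).

Definition Cbar J : 'M[int]_(l + #|J|, n + 1) := row_mx (C_ J) (c_ J).

Definition r_ J : nat := rankQ (C_ J).

Definition rbar_ J : nat := rankQ (Cbar J).

Definition d_ J j : nat := invariant_factor (C_ J) j.

Definition dbar_ J j : nat := invariant_factor (Cbar J) j.

Definition rho_C : nat := \big[lcmn/1%N]_(J | rbar_ J == r_ J) d_ J (r_ J).

Definition q0 : nat := (\max_(J | rbar_ J == (r_ J).+1) dbar_ J (rbar_ J))%N.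

Definition d_prod J q : nat := (\prod_(1 <= j < (r_ J).+1) gcdn (d_ J j) q)%N.

(* When [rbar_ J = (r_ J).+1], the last test reads [d_ J (r_ J).+1], which is 0. *)
Definition d_tilde J q : nat :=
  if all (fun j => gcdn q (d_ J j) == gcdn q (dbar_ J j)) (iota 1 (rbar_ J))
  then d_prod J q else 0%N.

Definition chi_quasi q : int :=
  \sum_(J : {set 'I_m} | rbar_ J == r_ J)
     (-1) ^+ #|J| * (d_tilde J q)%:Z * q%:Z ^+ (n - r_ J).

End CharacteristicQuasiPolynomial.

(* [f j] is only constrained for [1 <= j <= rho]. *)
Definition has_constituents (rho : nat) (g : nat -> int)
    (f : nat -> {poly rat}) : Prop :=
  forall j : nat, (1 <= j <= rho)%N ->
    unique (fun p : {poly rat} =>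
              forall q : nat, (0 < q)%N -> q = j %[mod rho] ->
                p.[q%:R] = (g q)%:~R)
           (f j).

Definition gcd_property (rho : nat) (f : nat -> {poly rat}) : Prop :=
  forall a b : nat, (1 <= a <= rho)%N -> (1 <= b <= rho)%N ->
    gcdn a rho = gcdn b rho -> f a = f b.

(* Main.v *)
Require Import Defs.
From mathcomp Require Import all_boot all_order all_algebra.

Set Implicit Arguments.
Unset Strict Implicit.
Unset Printing Implicit Defensive.

Import Order.TTheory GRing.Theory Num.Theory.
Local Open Scope ring_scope.

(** Only the subsets J with equal ranks contribute.  For such J, the largest
    invariant factor of an integer matrix M is the exponent of the torsion of
    coker M, and an integer vector is torsion in coker M iff it is annihilated
    by the left kernel of M.  Adding a column without raising the rank keeps
    the left kernel and enlarges the image, so the largest invariant factor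
    of [C_J c_J] divides that of C_J, hence divides rho_C.  Therefore all the
    gcds entering the coefficient of J depend on q only through
    gcd(q, rho_C). *)

Lemma invariant_factorsP (m n : nat) (M : 'M[int]_(m, n)) :
  is_invariant_factors M (invariant_factors M).
Proof. exact: svalP (invariant_factors_exist M). Qed.

Lemma dvdn_invariant_factor (m n : nat) (M : 'M[int]_(m, n)) (i j : nat) :
  (i <= j <= rankQ M)%N -> (invariant_factor M i %| invariant_factor M j)%N.
Proof.
case: i j => [|i] [|j] /andP[le_ij lt_j] //.
have [_ _ s_sorted _] := invariant_factorsP M.
rewrite -size_invariant_factors in lt_j.
apply: (sorted_leq_nth dvdn_trans dvdnn) => //.
by rewrite inE (leq_trans le_ij).
Qed.

Lemma invariant_factor_gt0 (m n : nat) (M : 'M[int]_(m, n)) (j : nat) :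
  (j <= rankQ M)%N -> (0 < invariant_factor M j)%N.
Proof.
case: j => // j; rewrite -size_invariant_factors => lt_j.
have [_ /allP s_gt0 _ _] := invariant_factorsP M.
exact/s_gt0/mem_nth.
Qed.

Lemma smith_diag_mulE (m n p : nat) (s : seq nat) (v : 'M[int]_(n, p))
    (i : 'I_m) (j : 'I_n) (k : 'I_p) : i = j :> nat ->
  (smith_diag m n s *m v) i k = (nth 0%N s i)%:Z * v j k.
Proof.
move=> eq_ij; rewrite mxE (bigD1 j) //= mxE eq_ij eqxx big1 ?addr0 // => h hj.
by rewrite mxE eq_ij eq_sym (negPf (hj : h != j :> nat)) mul0r.
Qed.

(** In the coordinates [y = invmx L *m x] the matrix becomes diagonal: [y] vanishes beyond the rank,
    and each nonzero diagonal entry divides the last one [e], so [e y] is reached coordinatewise. *)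
Lemma last_invariant_factor_torsion (m n : nat) (M : 'M[int]_(m, n))
    (x : 'cV[int]_m) :
  (forall u : 'rV_m, u *m M = 0 -> u *m x = 0) ->
  exists z, (invariant_factor M (rankQ M))%:Z *: x = M *m z.
Proof.
have [le_s _ _ [L [R [uL uR defM]]]] := invariant_factorsP M.
move: le_s; rewrite leq_min => /andP[le_sm le_sn] annM.
set e := invariant_factor _ _; set s := invariant_factors M in defM le_sm le_sn.
pose y := invmx L *m x.
(* Row [i] of [smith_diag] is zero here, so row [i] of [invmx L] lies in the left kernel of [M]. *)
have y0 (i : 'I_m) : (size s <= i)%N -> y i 0 = 0.
  move=> le_si.
  have ker_i : delta_mx 0 i *m invmx L *m M = 0 :> 'rV_n.
    rewrite {1}defM -!mulmxA mulKmx // !mulmxA; apply/rowP=> j.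
    rewrite -rowE !mxE big1 // => k _.
    by rewrite !mxE nth_default // mul0rn mul0r.
  have /matrixP/(_ 0 0) := annM _ ker_i.
  by rewrite -mulmxA -rowE -/y !mxE.
(* [insub] reads the column index [j] as a row index. Beyond the rank the quotient is by 0, so these
   entries are 0. *)
pose w : 'cV[int]_n := \col_j
  (if (insub (val j) : option 'I_m) is Some i
   then (e %/ nth 0%N s j)%N%:Z * y i 0 else 0).
exists (invmx R *m w).
rewrite defM -!mulmxA mulKVmx //.
rewrite -[x in LHS](mulKVmx uL) -/y scalemxAr; congr (_ *m _).
apply/colP=> i; rewrite mxE.
have [lt_is | le_si] := ltnP i (size s); last first.
  rewrite y0 // mulr0 mxE big1 // => k _.
  by rewrite mxE nth_default // mul0rn mul0r.
pose j := Ordinal (leq_trans lt_is le_sn).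
rewrite (@smith_diag_mulE _ _ _ _ _ i j) // [w j 0]mxE insubT //= => lt_im.
rewrite mulrA -PoszM mulnC divnK.
  by congr (_ * y _ _); apply: val_inj.
apply: (@dvdn_invariant_factor _ _ M i.+1 (rankQ M)).
by rewrite leqnn andbT -size_invariant_factors.
Qed.

(** Minimality of the exponent: it suffices to test the generator of the last cyclic torsion factor,
    the column of [L] at the last nonzero diagonal entry. *)
Lemma last_invariant_factor_dvd (m n : nat) (M : 'M[int]_(m, n)) (e : nat) :
  (forall x : 'cV[int]_m, (forall u : 'rV_m, u *m M = 0 -> u *m x = 0) ->
     exists z, e%:Z *: x = M *m z) ->
  (invariant_factor M (rankQ M) %| e)%N.
Proof.
have [le_s _ _ [L [R [uL uR defM]]]] := invariant_factorsP M.
move=> annM; have := @invariant_factor_gt0 _ _ M _ (leqnn _).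
case def_r: (rankQ M) => [|r] /= d_gt0; first exact: dvd1n.
have lt_rs : (r < minn m n)%N.
  by rewrite -def_r -size_invariant_factors in le_s *.
move: lt_rs; rewrite leq_min => /andP[lt_rm lt_rn].
pose i := Ordinal lt_rm; pose j := Ordinal lt_rn.
have [u uM0|z] := annM (L *m delta_mx i 0).
  (* Column [r] of this product is entry [r] of [u *m L] times a positive invariant factor, so that
     entry is 0. *)
  have: u *m L *m smith_diag m n (invariant_factors M) = 0.
    by rewrite -[LHS](mulmxK uR) -[_ *m R]mulmxA -[_ *m _ *m _]mulmxA
      [L *m _]mulmxA -defM uM0 mul0mx.
  move=> /matrixP/(_ 0 j); rewrite mxE (bigD1 i) //= big1 => [|k kj]; last first.
    by rewrite [smith_diag _ _ _ _ _]mxE (negPf (kj : k != j :> nat)) mulr0.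
  rewrite [smith_diag _ _ _ _ _]mxE eqxx addr0 [RHS]mxE => /eqP.
  rewrite mulf_eq0 mulr1n eqz_nat (gtn_eqF d_gt0) orbF => /eqP uL0.
  by rewrite mulmxA -colE; apply/rowP=> k; rewrite !ord1 mxE uL0 mxE.
rewrite scalemxAr {1}defM -!mulmxA => /(can_inj (mulKmx uL)).
move=> /matrixP/(_ i 0); rewrite (@smith_diag_mulE _ _ _ _ _ i j) //.
rewrite !mxE !eqxx mulr1 => def_e.
change (((nth 0%N (invariant_factors M) r)%:Z %| e%:Z)%Z).
by rewrite def_e dvdz_mulr.
Qed.

(** Over the rationals the left kernel of the block matrix lies in that of [M]; equal ranks give
    equal dimensions, hence equality. Injectivity of [intr] brings the result back to integers. *)
Lemma left_kernel_row_mx (m n p : nat) (M : 'M[int]_(m, n)) (N : 'M[int]_(m, p))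
    (u : 'rV[int]_m) :
  rankQ (row_mx M N) = rankQ M -> u *m M = 0 -> u *m row_mx M N = 0.
Proof.
rewrite /rankQ map_row_mx; set MQ := map_mx _ M; set NQ := map_mx _ N => eq_rk.
have sub_ker : (kermx (row_mx MQ NQ) <= kermx MQ)%MS.
  apply/sub_kermxP; have := mulmx_ker (row_mx MQ NQ).
  by rewrite mul_mx_row -row_mx0 => /eq_row_mx[].
have eq_ker : (kermx MQ <= kermx (row_mx MQ NQ))%MS.
  by rewrite -(geq_leqif (mxrank_leqif_sup sub_ker)) !mxrank_ker eq_rk.
move=> uM0; have /sub_kermxP : (map_mx intr u <= kermx (row_mx MQ NQ))%MS.
  apply: submx_trans eq_ker; apply/sub_kermxP.
  by rewrite -map_mxM uM0 map_mx0.
rewrite -map_row_mx -map_mxM => uMN0.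
apply/matrixP=> i j; have /matrixP/(_ i j)/eqP := uMN0.
by rewrite !mxE intr_eq0 => /eqP.
Qed.

Lemma last_invariant_factor_row_mx (m n p : nat) (M : 'M[int]_(m, n))
    (N : 'M[int]_(m, p)) : rankQ (row_mx M N) = rankQ M ->
  (invariant_factor (row_mx M N) (rankQ M) %| invariant_factor M (rankQ M))%N.
Proof.
move=> eq_rk; rewrite -{1}eq_rk; apply: last_invariant_factor_dvd => x annMN.
have [|z ->] := @last_invariant_factor_torsion _ _ M x.
  by move=> u uM0; apply/annMN/left_kernel_row_mx.
by exists (col_mx z 0); rewrite mul_row_col mulmx0 addr0.
Qed.

Lemma poly_eq_on_progression (R : numDomainType) (p1 p2 : {poly R})
    (j rho : nat) : (0 < rho)%N ->
  (forall k : nat, p1.[(j + k * rho)%:R] = p2.[(j + k * rho)%:R]) -> p1 = p2.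
Proof.
move=> rho_gt0 eq_p; apply/eqP; rewrite -subr_eq0; apply/negPn/negP => nz_p.
(* The size exceeds the degree by one, so these are too many roots for a nonzero difference. *)
pose rs : seq R := [seq (j + k * rho)%:R | k <- iota 0 (size (p1 - p2))].
have := @max_poly_roots _ _ rs nz_p; rewrite size_map size_iota ltnn.
suff [-> ->] : all (root (p1 - p2)) rs /\ uniq rs by move=> /(_ isT isT).
split; first by apply/allP=> _ /mapP[k _ ->]; rewrite rootE !hornerE eq_p subrr.
rewrite map_inj_uniq ?iota_uniq // => k1 k2 /eqP.
by rewrite eqr_nat eqn_add2l eqn_pmul2r // => /eqP.
Qed.

(** Since [d = gcdn rho d], [gcdn a d = gcdn (gcdn a rho) d]. *)
Lemma eq_gcdn_dvd (a b d rho : nat) : (d %| rho)%N ->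
  gcdn a rho = gcdn b rho -> gcdn a d = gcdn b d.
Proof. by move=> /gcdn_idPr <- eq_ab; rewrite !gcdnA eq_ab. Qed.

Lemma eq_d_tilde (m l n : nat)
    (A : 'M[int]_(m, n)) (av : 'cV[int]_m)
    (B : 'M[int]_(l, n)) (bv : 'cV[int]_l) (J : {set 'I_m}) (a b : nat) :
  rbar_ A av B bv J = r_ A B J ->
  gcdn a (rho_C A av B bv) = gcdn b (rho_C A av B bv) ->
  d_tilde A av B bv J a = d_tilde A av B bv J b.
Proof.
move=> eq_r; set rho := rho_C _ _ _ _ => eq_ab.
have dr_rho : (d_ A B J (r_ A B J) %| rho)%N.
  by rewrite /rho /rho_C (bigD1 J) ?eq_r //= dvdn_lcml.
have d_rho j : (j <= r_ A B J)%N -> (d_ A B J j %| rho)%N.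
  move=> le_j; apply: dvdn_trans dr_rho.
  by apply: dvdn_invariant_factor; rewrite le_j /=.
(* With [r] the common rank, the chain is: [dbar_j] divides [dbar_r], which divides [d_r], which
   divides [rho]. *)
have dbar_rho j : (j <= r_ A B J)%N -> (dbar_ A av B bv J j %| rho)%N.
  move=> le_j; apply: dvdn_trans dr_rho.
  apply: dvdn_trans (last_invariant_factor_row_mx eq_r).
  by apply: dvdn_invariant_factor; rewrite le_j; apply: eq_leq (esym eq_r).
rewrite /d_tilde eq_r.
have -> : all (fun j => gcdn a (d_ A B J j) == gcdn a (dbar_ A av B bv J j))
            (iota 1 (r_ A B J)) =
          all (fun j => gcdn b (d_ A B J j) == gcdn b (dbar_ A av B bv J j))
            (iota 1 (r_ A B J)).
  apply: eq_in_all => j; rewrite mem_iota add1n ltnS => /andP[_ le_j].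
  by rewrite (eq_gcdn_dvd (d_rho j le_j) eq_ab)
             (eq_gcdn_dvd (dbar_rho j le_j) eq_ab).
case: ifP => // _; apply: eq_big_nat => j; rewrite ltnS => /andP[_ le_j].
by rewrite !(gcdnC (d_ A B J j)) (eq_gcdn_dvd (d_rho j le_j) eq_ab).
Qed.

Theorem theorem2p5 (m l n : nat)
    (A : 'M[int]_(m, n)) (av : 'cV[int]_m)
    (B : 'M[int]_(l, n)) (bv : 'cV[int]_l) :
  let rho := rho_C A av B bv in
  let chi := chi_quasi A av B bv in
  exists f : nat -> {poly rat},
    has_constituents rho chi f /\
    [/\ forall a : nat, (1 <= a <= rho)%N ->
          f a = \sum_(J : {set 'I_m} | rbar_ A av B bv J == r_ A B J)
                  ((-1) ^+ #|J| * (d_tilde A av B bv J a)%:R)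
                    *: 'X^(n - r_ A B J),
        gcd_property rho f
      & forall q a : nat, (q0 A av B bv < q)%N -> (1 <= a <= rho)%N ->
          gcdn q rho = a ->
          (chi q)%:~R = (f a).[q%:R]].
Proof.
move=> rho chi.
pose f a : {poly rat} := \sum_(J : {set 'I_m} | rbar_ A av B bv J == r_ A B J)
  ((-1) ^+ #|J| * (d_tilde A av B bv J a)%:R) *: 'X^(n - r_ A B J).
(* Congruence modulo [rho] is one way to get equal gcds, which gives the constituents; taking
   [a = gcdn q rho] is another, which gives the last claim. *)
have chiE q a : gcdn q rho = gcdn a rho -> (f a).[q%:R] = (chi q)%:~R.
  move=> eq_qa; rewrite /f /chi /chi_quasi rmorph_sum horner_sum.
  apply: eq_bigr => J /eqP eq_r.
  by rewrite (eq_d_tilde eq_r eq_qa) !hornerE !rmorphM !rmorphXn rmorphN1.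
exists f; split=> [j /andP[j_gt0 le_j]|]; last split=> //.
- split=> [q _ eq_qj | p pE].
    by apply: chiE; rewrite -gcdn_modl eq_qj gcdn_modl.
  apply: (@poly_eq_on_progression _ _ _ j rho) => [|k].
    exact: leq_trans le_j.
  have eq_j : (j + k * rho = j %[mod rho])%N by rewrite addnC modnMDl.
  rewrite pE ?addn_gt0 ?j_gt0 // chiE //.
  by rewrite -gcdn_modl eq_j gcdn_modl.
- move=> a b _ _ eq_ab; apply: eq_bigr => J /eqP eq_r.
  by rewrite (eq_d_tilde eq_r eq_ab).
- move=> q a _ _ <-; rewrite chiE // -gcdnA gcdnn //.
Qed.
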